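(* Let $p$ be a prime, $n=rk$ with $r>1$, and let $f(x)=x^d$ on $\mathbb{F}_{p^n}$, where $1\le d\le p^n-1$. (i) The image set of $f$ is contained in $\mathbb{F}_{p^k}$ if and only if $d$ is of the form $$d=j\left(p^{k(r-1)}+p^{k(r-2)}+\dots+p^k+1\right)$$ for some $j\in\{1,\ldots,p^k-1\}$. (ii) If $f$ maps $\mathbb{F}_{p^n}$ to $\mathbb{F}_{p^k}$, then $f:\mathbb{F}_{p^n}\to\mathbb{F}_{p^k}$ does not have a linear translator (i.e. there are no $\gamma\in\mathbb{F}_{p^n}^*$ and $b\in\mathbb{F}_{p^k}$ such that $\gamma$ is a $b$-linear translator of $f$).
   Context: For $f:\mathbb{F}_{p^n}\to\mathbb{F}_{p^k}$ with $k\mid n$, $\gamma\in\mathbb{F}_{p^n}^*$ is a $b$-linear translator of $f$ ($b\in\mathbb{F}_{p^k}$) if $f(x+u\gamma)-f(x)=ub$ for all $x\in\mathbb{F}_{p^n}$ and all $u\in\mathbb{F}_{p^k}$. *)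

(* Defs.v *)
From mathcomp Require Import all_boot all_algebra all_field.

Set Implicit Arguments.
Unset Strict Implicit.
Unset Printing Implicit Defensive.

Import GRing.Theory.

Local Open Scope ring_scope.

(* gamma is a b-linear translator of f : L -> K, where K is a subfield of the
   finite field L; f is typed with codomain L, and that its values lie in K is
   left as a separate hypothesis. *)
Definition linear_translator (L : finFieldType) (K : {set L}) (f : L -> L)
    (b gamma : L) : Prop :=
  [/\ gamma != 0, b \in K
    & forall x u : L, u \in K -> f (x + u * gamma) - f x = u * b].

(* Main.v *)
(* Let q = p^k, so that K^* is exactly the set of (q-1)-st roots of unity of L.
   Evaluating at a generator of L^*, x^d takes values in K iff q^r - 1 divides
   d(q - 1), i.e. iff 1 + q + ... + q^(r-1) divides d. For (ii), if gamma is a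
   b-linear translator then b = f(gamma) <> 0, so u = - f(x) / b lies in K and
   f(x + u gamma) = 0, hence x = - u gamma: all of L would lie in K gamma,
   contradicting #|K| < #|L|. *)
Require Import Defs.
From mathcomp Require Import all_boot all_fingroup all_algebra all_solvable.
From mathcomp Require Import all_field.

Set Implicit Arguments.
Unset Strict Implicit.
Unset Printing Implicit Defensive.

Import GRing.Theory.

Local Open Scope ring_scope.

Section FiniteSubfield.

Variables (L : finFieldType) (K : {set L}).
Hypothesis Kfield : GRing.divring_closed K.

Lemma subfield1 : 1 \in K.
Proof. by case: Kfield. Qed.

Lemma subfield0 : 0 \in K.
Proof. by case: Kfield => K1 KB _; rewrite -(subrr 1) KB. Qed.

Lemma subfieldN x : x \in K -> - x \in K.
Proof. by case: Kfield => _ KB _ Kx; rewrite -sub0r KB ?subfield0. Qed.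

Lemma subfieldV x : x \in K -> x^-1 \in K.
Proof. by case: Kfield => K1 _ KV Kx; rewrite -div1r KV. Qed.

Lemma subfieldM x y : x \in K -> y \in K -> x * y \in K.
Proof.
by case: Kfield => _ _ KV Kx Ky; rewrite -[y]invrK KV ?subfieldV.
Qed.

Lemma card_subfield_gt1 : (1 < #|K|)%N.
Proof.
apply/card_gt1P; exists 0, 1.
by split; rewrite ?subfield0 ?subfield1 // eq_sym oner_neq0.
Qed.

Lemma card_subfieldD1 : #|K :\ 0| = #|K|.-1.
Proof. by rewrite [in RHS](cardsD1 0) subfield0. Qed.

(** Multiplication by [x] permutes [K :\ 0], so the product [P] of its elements absorbs the factor
    [x ^+ #|K|.-1]; as [P] is nonzero, it cancels. *)
Lemma subfield_expf_card x : x \in K -> x != 0 -> x ^+ #|K|.-1 = 1.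
Proof.
move=> Kx x0; set P := \prod_(y in K :\ 0) y.
have P0 : P != 0 by apply/prodf_neq0 => y; rewrite !inE => /andP[].
apply: (mulIf P0); rewrite mul1r -card_subfieldD1 -prodr_const -big_split /=.
rewrite [RHS](reindex_inj (mulfI x0)); apply: eq_bigl => y.
rewrite !inE mulf_eq0 (negPf x0) /=; congr (_ && _).
apply/idP/idP => [|Kxy]; first exact: subfieldM.
by rewrite -[y](mulKf x0) subfieldM ?subfieldV.
Qed.

(** The polynomial X^(#|K| - 1) - 1 has at most #|K| - 1 roots, and [K :\ 0] already supplies that
    many; a root outside [K] would be one too many. *)
Lemma subfield_mem_exp x : x != 0 -> (x \in K) = (x ^+ #|K|.-1 == 1).
Proof.
move=> x0; apply/idP/eqP => [Kx|x1]; first exact: subfield_expf_card.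
apply: contraT => K'x.
have m_gt0 : (0 < #|K|.-1)%N by rewrite -subn1 subn_gt0 card_subfield_gt1.
have := @max_unity_roots _ _ (x :: enum (K :\ 0)) m_gt0.
rewrite /= -cardE card_subfieldD1 ltnn; apply.
  apply/andP; split; first exact/unity_rootP.
  apply/allP => y; rewrite mem_enum !inE => /andP[y0 Ky].
  by apply/unity_rootP/subfield_expf_card.
by rewrite enum_uniq mem_enum !inE (negPf K'x) andbF.
Qed.

Lemma pow_subfieldP d : (0 < d)%N ->
  (forall x : L, x ^+ d \in K) <-> (#|L|.-1 %| d * #|K|.-1)%N.
Proof.
move=> d_gt0; split=> [fK|].
  have /cyclicP[g defU] := field_unit_group_cyclic [group of [set: {unit L}]].
  (* The order of [g] is #|L| - 1, so the divisibility says that the (#|K| - 1)-st power of [g ^+ d]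
     is 1, i.e. that [g ^+ d] lies in [K]. *)
  rewrite -card_finField_unit defU -/(order g) order_dvdn -val_eqE /=.
  rewrite FinRing.val_unitX exprM -subfield_mem_exp ?fK // expf_neq0 //.
  by rewrite -unitfE; exact: (valP g).
case/dvdnP=> m dm x; have [->|x0] := eqVneq x 0.
  by rewrite expr0n eqn0Ngt d_gt0 subfield0.
rewrite subfield_mem_exp ?expf_neq0 // -exprM dm mulnC exprM.
suff -> : x ^+ #|L|.-1 = 1 by rewrite expr1n.
apply: (mulfI x0); rewrite -exprS mulr1 prednK ?expf_card //.
by apply/card_gt0P; exists x.
Qed.

Lemma pow_no_linear_translator d (b gamma : L) :
    (0 < d)%N -> (#|K| < #|L|)%N -> (forall x : L, x ^+ d \in K) ->
  ~ linear_translator K (fun x => x ^+ d) b gamma.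
Proof.
move=> d_gt0 ltKL fK [gamma0 Kb trans].
(* Taking x = 0 and u = 1 gives b = gamma^d, since 0^d = 0 for d > 0. *)
have b0 : b != 0.
  have := trans 0 1 subfield1; rewrite add0r !mul1r expr0n eqn0Ngt d_gt0 subr0.
  by move<-; rewrite expf_neq0.
suff : (#|L| <= #|K|)%N by rewrite leqNgt ltKL.
rewrite -(card_imset _ (mulIf gamma0)) -cardsT; apply/subset_leq_card/subsetP.
move=> x _; pose u := x ^+ d / b.
have Ku : u \in K by rewrite subfieldM ?subfieldV.
apply/imsetP; exists u => //.
(* Translating by [- u] gives (x - u gamma)^d = x^d - u b = 0, hence x = u gamma. *)
have /eqP := trans x (- u) (subfieldN Ku).
rewrite mulNr [- u * b]mulNr divfK // subr_eq addNr expf_eq0 d_gt0 subr_eq0.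
by move/eqP.
Qed.

End FiniteSubfield.

Theorem proposition1 (p n r k d : nat) (L : finFieldType) (K : {set L})
    (hp : prime p) (hn : n = (r * k)%N) (hr : (1 < r)%N)
    (hL : #|L| = (p ^ n)%N)
    (hKfield : GRing.divring_closed K) (hK : #|K| = (p ^ k)%N)
    (hd : (1 <= d <= p ^ n - 1)%N) :
  let f := fun x : L => x ^+ d in
  ([set f x | x : L] \subset K <->
     exists2 j : nat, (1 <= j <= p ^ k - 1)%N
                    & d = (j * \sum_(0 <= i < r) p ^ (k * i))%N)
  /\ ((forall x : L, f x \in K) ->
      ~ exists gamma b : L, linear_translator K f b gamma).
Proof.
move=> f; case/andP: hd => d_gt0 d_le.
have q_gt1 : (1 < p ^ k)%N by rewrite -hK card_subfield_gt1.
set S := (\sum_(0 <= i < r) _)%N.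
(* Geometric series with ratio q = p^k: q^r - 1 = (q - 1) S. *)
have pnE : ((p ^ n).-1 = (p ^ k).-1 * S)%N.
  rewrite hn mulnC expnM predn_exp /S big_mkord; congr (_ * _)%N.
  by apply: eq_bigr => i _; rewrite expnM.
have q1_gt0 : (0 < (p ^ k).-1)%N by rewrite -subn1 subn_gt0.
have imfK : [set f x | x : L] \subset K <-> (S %| d)%N.
  (* Scaling by q - 1 > 0 turns S | d into q^r - 1 | d (q - 1), the criterion of [pow_subfieldP]. *)
  rewrite -(dvdn_pmul2r q1_gt0) [(S * _)%N]mulnC -pnE -hL -hK.
  apply: iff_trans (pow_subfieldP hKfield d_gt0); split=> [/subsetP fK x|fK].
    by apply: fK; apply: imset_f.
  by apply/subsetP => _ /imsetP[x _ ->]; apply: fK.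
split; last first.
  move=> fK [gamma [b]]; apply: pow_no_linear_translator => //.
  by rewrite hL hK hn mulnC expnM -[ltnLHS]expn1 ltn_exp2l.
apply: (iff_trans imfK); split=> [/dvdnP[j dE]|[j _ ->]]; last exact: dvdn_mull.
(* Both bounds on [j] come from 0 < j S <= (q - 1) S by cancelling S > 0. *)
exists j => //; move: d_gt0 d_le; rewrite !subn1 pnE dE muln_gt0.
by case/andP=> -> S_gt0; rewrite leq_pmul2r.
Qed.
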